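(* Let $K$ be the graph with vertex set $\{x,y,z,z',t,t',w\}$ and exactly the edges $xy, xt, xt', yt, yt', yz, yz', tz, zz', z't', wt, wz, wz', wt'$. Let $G$ be the infinite graph obtained as follows: take copies $K_1,K_2,K_3,\ldots$ of $K$ (with the vertices of $K_i$ denoted $x_i,y_i,z_i,z_i',t_i,t_i',w_i$), pairwise disjoint except that $y_i$ is identified with $x_{i+1}$ for every $i\ge 1$, and then add one new vertex $0$ that is joined to all the vertices $x_i$ and $y_i$ ($i\geq 1$) and to no other vertices. Then $G$ is cop-win, but $G$ is not constructible.
   Context: Graphs are undirected, loopless and connected. Cops and robbers: on a (finite or infinite) graph $G$, the cop picks a starting vertex, then the robber picks a starting vertex; then they move alternately, with the cop moving first. At each turn the player moves to an adjacent vertex or does not move. The cop wins if he lands on the robber (in finite time). $G$ is cop-win if the cop has a winning strategy. Domination: a vertex $u$ dominates a vertex $v\ne u$ in a graph if the set consisting of $v$ and all neighbours of $v$ is contained in the set consisting of $u$ and all neighbours of $u$. Constructible: $G$ is constructible if there is an ordinal $\beta$ such that its vertices can be listed (without repetition) as $(x_\alpha)_{\alpha<\beta}$ so that for every $0<\alpha<\beta$ the vertex $x_\alpha$ is dominated in the induced graph $G[\{x_\gamma:\gamma\le\alpha\}]$ by some $x_\gamma$ with $\gamma<\alpha$. *)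

(* Defs.v *)
From Stdlib Require Import List Arith Lia FinFun Relations.
Import ListNotations.

Record graph := Graph {
  vertex :> Type;
  adj : vertex -> vertex -> Prop;
  adj_sym : forall u v, adj u v -> adj v u;
  adj_irrefl : forall u, ~ adj u u
}.
Arguments adj {g} _ _.

(* Connectedness is kept out of [graph] so that induced graphs are graphs; the
   two concrete graphs below are shown to be connected. *)
Definition connected (H : graph) : Prop :=
  forall u v : H, clos_refl_trans H adj u v.

Definition closed_nbhd {H : graph} (u : H) : H -> Prop :=
  fun a => a = u \/ adj u a.

Definition dominates {H : graph} (u v : H) : Prop :=
  u <> v /\ forall a : H, closed_nbhd v a -> closed_nbhd u a.

Definition induced (H : graph) (S : H -> Prop) : graph :=
  Graph {v : H | S v}
    (fun u v => adj (proj1_sig u) (proj1_sig v))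
    (fun u v => adj_sym H (proj1_sig u) (proj1_sig v))
    (fun u => adj_irrefl H (proj1_sig u)).

(* [r n] is the position of the robber after his [n]-th move ([r 0] is his
   starting vertex).  A strategy of the cop maps the finite sequence of
   robber positions seen so far, in chronological order, to the vertex occupied
   by the cop next; its value at [nil] is the cop's starting vertex.  (The cop's
   own past positions are determined by this data.)  So the cop chooses
   [cop_pos s r 0], the robber [r 0], the cop [cop_pos s r 1], the robber
   [r 1], and so on. *)
Definition step {H : graph} (u v : H) : Prop := v = u \/ adj u v.

Definition robber_play {H : graph} (r : nat -> H) : Prop :=
  forall n, step (r n) (r (S n)).

Definition cop_pos {H : graph} (s : list H -> H) (r : nat -> H) (n : nat) : H :=
  s (map r (seq 0 n)).

(* A play is continued formally after a capture: a cop who has landed on the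
   robber can then simply stay put, so legality is required at all times. *)
Definition winning_strategy {H : graph} (s : list H -> H) : Prop :=
  forall r : nat -> H, robber_play r ->
    (forall n, step (cop_pos s r n) (cop_pos s r (S n))) /\
    (exists n, cop_pos s r (S n) = r n).

Definition cop_win (H : graph) : Prop :=
  exists s : list H -> H, winning_strategy s.

(* Ordinals are represented by well-ordered types: the elements of the type
   stand for the ordinals below the given one. *)
Record ordinal := Ordinal {
  below :> Type;
  olt : below -> below -> Prop;
  olt_trans : forall a b c, olt a b -> olt b c -> olt a c;
  olt_total : forall a b, olt a b \/ a = b \/ olt b a;
  olt_wf : well_founded olt
}.
Arguments olt {o} _ _.

Definition upto {H : graph} {beta : ordinal} (x : beta -> H) (a : beta) :
    H -> Prop :=
  fun v => exists c : beta, (olt c a \/ c = a) /\ v = x c.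

(* The hypothesis [exists b, olt b a] says [0 < a]. *)
Definition constructible (H : graph) : Prop :=
  exists (beta : ordinal) (x : beta -> H),
    Injective x /\ Surjective x /\
    forall a : beta, (exists b : beta, olt b a) ->
      exists c : beta, olt c a /\
        exists u v : induced H (upto x a),
          proj1_sig u = x c /\ proj1_sig v = x a /\ dominates u v.

Inductive K_vertex := Kx | Ky | Kz | Kz' | Kt | Kt' | Kw.

Definition K_edges : list (K_vertex * K_vertex) :=
  [(Kx, Ky); (Kx, Kt); (Kx, Kt'); (Ky, Kt); (Ky, Kt'); (Ky, Kz); (Ky, Kz');
   (Kt, Kz); (Kz, Kz'); (Kz', Kt'); (Kw, Kt); (Kw, Kz); (Kw, Kz'); (Kw, Kt')].

Definition K_adj (a b : K_vertex) : Prop :=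
  In (a, b) K_edges \/ In (b, a) K_edges.

Lemma K_adj_sym (a b : K_vertex) : K_adj a b -> K_adj b a.
Proof. unfold K_adj; tauto. Qed.

Lemma K_adj_irrefl (a : K_vertex) : ~ K_adj a a.
Proof.
  unfold K_adj; simpl; intros H;
    repeat (destruct H as [H | H]); congruence || contradiction.
Qed.

Definition K : graph := Graph K_vertex K_adj K_adj_sym K_adj_irrefl.

(* Copies are numbered from 0, so copy [i] here is K_(i+1) in the usual
   numbering.  There is no constructor for the vertices y_i: they are the
   vertices x_(i+1), see [copy] and [copy_eq]. *)
Inductive G_vertex :=
  | G0
  | Gx (i : nat) | Gz (i : nat) | Gz' (i : nat)
  | Gt (i : nat) | Gt' (i : nat) | Gw (i : nat).

Definition copy (i : nat) (a : K) : G_vertex :=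
  match a with
  | Kx => Gx i
  | Ky => Gx (S i)
  | Kz => Gz i
  | Kz' => Gz' i
  | Kt => Gt i
  | Kt' => Gt' i
  | Kw => Gw i
  end.

Lemma copy_eq (i j : nat) (a b : K) :
  copy i a = copy j b <->
    (i = j /\ a = b) \/
    (a = Ky /\ b = Kx /\ j = S i) \/ (a = Kx /\ b = Ky /\ i = S j).
Proof.
  split.
  - destruct a, b; simpl; intros H; try discriminate H; injection H as H; subst;
      auto.
  - intros [[-> ->] | [[-> [-> ->]] | [-> [-> ->]]]]; reflexivity.
Qed.

Lemma G_vertex_cover (v : G_vertex) : v = G0 \/ exists i a, v = copy i a.
Proof.
  destruct v as [| i | i | i | i | i | i]; [now left | right; exists i ..];
    [exists Kx | exists Kz | exists Kz' | exists Kt | exists Kt' | exists Kw];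
    reflexivity.
Qed.

Inductive G_adj : G_vertex -> G_vertex -> Prop :=
  | G_adj_copy i (a b : K) : adj a b -> G_adj (copy i a) (copy i b)
  | G_adj_0x i : G_adj G0 (copy i Kx)
  | G_adj_x0 i : G_adj (copy i Kx) G0
  | G_adj_0y i : G_adj G0 (copy i Ky)
  | G_adj_y0 i : G_adj (copy i Ky) G0.

Lemma G_adj_sym (u v : G_vertex) : G_adj u v -> G_adj v u.
Proof.
  intros []; [now apply G_adj_copy, adj_sym | constructor ..].
Qed.

Lemma G_adj_irrefl (u : G_vertex) : ~ G_adj u u.
Proof.
  intros H; inversion H as [i a b Hab Ha Hb | | | |];
    try (subst u; discriminate).
  assert (E : copy i a = copy i b) by congruence.
  apply copy_eq in E as [[_ ->] | [[_ [_ E]] | [_ [_ E]]]]; try lia.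
  exact (adj_irrefl K b Hab).
Qed.

Definition G : graph := Graph G_vertex G_adj G_adj_sym G_adj_irrefl.

Lemma connected_from (H : graph) (o : H) :
  (forall v, clos_refl_trans H adj v o) -> connected H.
Proof.
  intros Ho u v. apply rt_trans with o; [apply Ho |].
  generalize (Ho v); generalize o; clear; intros o H'.
  induction H' as [a b Hab | a | a b c _ IH1 _ IH2].
  - apply rt_step. exact (adj_sym H a b Hab).
  - apply rt_refl.
  - now apply rt_trans with b.
Qed.

Lemma K_to_Ky (a : K) : clos_refl_trans K adj a Ky.
Proof.
  assert (Hz : clos_refl_trans K adj Kz Ky)
    by (apply rt_step; cbn; unfold K_adj; simpl; tauto).
  destruct a; [| apply rt_refl | exact Hz | | | |
    apply rt_trans with (Kz : K); [| exact Hz]];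
    apply rt_step; cbn; unfold K_adj; simpl; tauto.
Qed.

Lemma K_connected : connected K.
Proof. exact (connected_from K Ky K_to_Ky). Qed.

Lemma G_connected : connected G.
Proof.
  apply (connected_from G G0); intros v.
  destruct (G_vertex_cover v) as [-> | [i [a ->]]]; [apply rt_refl |].
  apply rt_trans with (copy i Ky : G); [| apply rt_step, G_adj_y0].
  generalize (K_to_Ky a); generalize (Ky : K); clear; intros d H.
  induction H as [b c Hbc | b | b c d _ IH1 _ IH2].
  - apply rt_step. exact (G_adj_copy i b c Hbc).
  - apply rt_refl.
  - now apply rt_trans with (copy i c : G).
Qed.

(* Main.v *)
(** The cop guards the vertex 0.  A robber who is not captured at once hides
    inside some copy [K_i], from which the cop drives him through [y_i], [z_i]
    and [z_i'] to [x_i].  With the cop at [y_i] he can leave [x_i] only towards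
    copies of smaller index, so that after the cop's return to 0 the index has
    decreased; in the first copy he is captured.

    On the other hand, the only vertex of [K_i] that can be the last vertex of
    [K_i] in a constructing order is [x_i], so [x_(i+1) = y_i] comes before [x_i].
    This gives an infinite descending sequence of ordinals. *)

Require Import Defs.
From Stdlib Require Import List Arith Lia FinFun.
Import ListNotations.

(** * Memoryless cop strategies *)

(** Positions with the cop to move; inductive, so that no bound on the number of moves has to be
    tracked. *)
Inductive caught {H : graph} (f : H -> H -> H) : H -> H -> Prop :=
  | caught_now c r : f c r = r -> caught f c r
  | caught_later c r :
      (forall r', step r r' -> caught f (f c r) r') -> caught f c r.

Lemma positional_cop_win (H : graph) (f : H -> H -> H) (c0 : H) :
  (forall c r, step c (f c r)) -> (forall r, caught f c0 r) -> cop_win H.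
Proof.
  intros Hf Hc. set (s := fun l => fold_left f l c0).
  exists s. intros r Hr.
  assert (pos_S : forall n, cop_pos s r (S n) = f (cop_pos s r n) (r n)).
  { intros n. unfold cop_pos, s.
    now rewrite seq_S, map_app, fold_left_app. }
  split; [intros n; rewrite pos_S; apply Hf |].
  assert (Hwin : forall c q, caught f c q -> forall n,
    c = cop_pos s r n -> q = r n -> exists m, cop_pos s r (S m) = r m).
  { intros c q Hq; induction Hq as [c q E | c q _ IH]; intros n -> ->.
    - exists n. now rewrite pos_S.
    - apply (IH (r (S n)) (Hr n) (S n)); [now rewrite pos_S | reflexivity]. }
  now apply (Hwin c0 (r 0) (Hc (r 0)) 0).
Qed.

(** * Neighbour lists and decidability of moves *)

Definition K_nbrs (a : K) : list K :=
  match a with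
  | Kx => [Ky; Kt; Kt']
  | Ky => [Kx; Kt; Kt'; Kz; Kz']
  | Kz => [Ky; Kt; Kz'; Kw]
  | Kz' => [Ky; Kz; Kt'; Kw]
  | Kt => [Kx; Ky; Kz; Kw]
  | Kt' => [Kx; Ky; Kz'; Kw]
  | Kw => [Kt; Kz; Kz'; Kt']
  end.

Lemma K_nbrs_spec (a b : K) : adj a b <-> In b (K_nbrs a).
Proof.
  cbn; unfold K_adj; destruct a, b; simpl; intuition discriminate.
Qed.

(* The value at [G0], whose neighbourhood is infinite, is a junk value. *)
Definition G_nbrs (u : G) : list G :=
  match u with
  | G0 => []
  | Gx i =>
      G0 :: map (copy i) (K_nbrs Kx) ++
      match i with 0 => [] | S j => map (copy j) (K_nbrs Ky) end
  | Gz i => map (copy i) (K_nbrs Kz)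
  | Gz' i => map (copy i) (K_nbrs Kz')
  | Gt i => map (copy i) (K_nbrs Kt)
  | Gt' i => map (copy i) (K_nbrs Kt')
  | Gw i => map (copy i) (K_nbrs Kw)
  end.

Lemma G_nbrs_copy (i : nat) (a b : K) :
  In b (K_nbrs a) -> In (copy i b : G) (G_nbrs (copy i a)).
Proof.
  intros Hb; apply (in_map (copy i)) in Hb.
  destruct a; try exact Hb; cbn [G_nbrs copy]; right; apply in_or_app;
    [now left | now right].
Qed.

Lemma adj_G_nbrs (u v : G) : u <> G0 -> adj u v -> In v (G_nbrs u).
Proof.
  intros Hu Huv; destruct Huv as [i a b Hab | i | i | i | i];
    try contradiction; [| now left ..].
  now apply G_nbrs_copy, K_nbrs_spec.
Qed.

Lemma G_nbrs_adj (u v : G) : In v (G_nbrs u) -> adj u v.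
Proof.
  assert (Hcopy : forall i (a : K), In v (map (copy i) (K_nbrs a)) ->
    @adj G (copy i a) v).
  { intros i a Hv. apply in_map_iff in Hv as [b [<- Hb]].
    now apply G_adj_copy, K_nbrs_spec. }
  destruct u as [| i | i | i | i | i | i]; cbn [G_nbrs];
    [easy | | apply (Hcopy i Kz) | apply (Hcopy i Kz') | apply (Hcopy i Kt)
     | apply (Hcopy i Kt') | apply (Hcopy i Kw)].
  intros [<- | Hv]; [apply (G_adj_x0 i) |].
  apply in_app_or in Hv as [Hv | Hv]; [now apply (Hcopy i Kx) |].
  destruct i as [| j]; [easy | now apply (Hcopy j Ky)].
Qed.

Lemma step_G_nbrs (u v : G) : u <> G0 -> step u v -> In v (u :: G_nbrs u).
Proof.
  intros Hu [-> | Huv]; [now left | right; now apply adj_G_nbrs].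
Qed.

Lemma G_nbrs_step (u v : G) : In v (u :: G_nbrs u) -> step u v.
Proof.
  intros [-> | Huv]; [now left | right; now apply G_nbrs_adj].
Qed.

Lemma step_sym (H : graph) (u v : H) : step u v -> step v u.
Proof.
  intros [-> | Huv]; [now left | right; now apply adj_sym].
Qed.

Lemma G_eq_dec (u v : G) : {u = v} + {u <> v}.
Proof. repeat decide equality. Defined.

Lemma step_dec (u v : G) : {step u v} + {~ step u v}.
Proof.
  destruct (G_eq_dec u G0) as [Hu | Hu].
  - destruct (G_eq_dec v G0) as [Hv | Hv]; [left; left; congruence |].
    (* The list at [G0] carries no information, so the move is tested from the other end. *)
    destruct (in_dec G_eq_dec u (v :: G_nbrs v)) as [Huv | Huv].
    + left. now apply step_sym, G_nbrs_step.
    + right. intros Hs. now apply Huv, step_G_nbrs, step_sym.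
  - destruct (in_dec G_eq_dec v (u :: G_nbrs u)) as [Huv | Huv].
    + left. now apply G_nbrs_step.
    + right. intros Hs. now apply Huv, step_G_nbrs.
Defined.

(** * Capturing the robber *)

(** The plan while the robber is out of reach; [Gx (S i)] is the vertex y of copy [i]. Illegal
    values are harmless, since [chase] then stays put. *)
Definition approach (c r : G) : G :=
  match c, r with
  | G0, (Gz i | Gz' i | Gt i | Gt' i | Gw i) => Gx (S i)
  | Gx _, Gw i => Gz i
  | Gx _, _ => G0
  | Gz i, _ => Gz' i
  | Gz' i, _ => Gx (S i)
  | _, _ => c
  end.

Definition chase (c r : G) : G :=
  if step_dec c r then r
  else if step_dec c (approach c r) then approach c r else c.

Lemma chase_legal (c r : G) : step c (chase c r).
Proof.
  unfold chase. destruct (step_dec c r); [easy |].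
  destruct (step_dec c (approach c r)); [easy | now left].
Qed.

Lemma caught_step (c r : G) : step c r -> caught chase c r.
Proof.
  intros Hs. apply caught_now. unfold chase. now destruct (step_dec c r).
Qed.

Lemma caught_approach (c r : G) :
  r <> G0 -> step c (approach c r) ->
  (forall r', In r' (r :: G_nbrs r) -> caught chase (approach c r) r') ->
  caught chase c r.
Proof.
  intros Hr Hs Hc. destruct (step_dec c r) as [Hcr | Hcr].
  - now apply caught_step.
  - apply caught_later. intros r' Hr'. unfold chase at 2.
    destruct (step_dec c r) as [|_]; [easy |].
    destruct (step_dec c (approach c r)) as [_ |]; [| easy].
    now apply Hc, step_G_nbrs.
Qed.

Lemma step_G0_Gx (i : nat) : @step G G0 (Gx i).
Proof. right; apply (G_adj_0x i). Qed.

Ltac solve_step :=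
  first [apply step_G0_Gx | apply G_nbrs_step; simpl; tauto
        | apply step_sym, G_nbrs_step; simpl; tauto].

Ltac solve_approach :=
  apply caught_approach; [discriminate | simpl; solve_step |];
  let Hr := fresh in
  intros ? Hr; simpl in Hr;
  repeat destruct Hr as [<- | Hr]; try contradiction;
  try (apply caught_step; solve_step); auto.

Definition interior (i : nat) : list G := map (copy i) [Kz; Kz'; Kt; Kt'; Kw].

(** The cop steps from 0 to the vertex y of the copy, which attacks everything the robber can then
    occupy except w. *)
Lemma caught_interior (i : nat) :
  caught chase (Gx (S i) : G) (Gw i) ->
  forall r, In r (interior i) -> caught chase G0 r.
Proof.
  intros Hw r Hr; simpl in Hr.
  repeat destruct Hr as [<- | Hr]; try contradiction; solve_approach.
Qed.

(** Covers the moment after the robber has left [Gx (S i)] downwards. The cop returns to 0, and the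
    robber's next move ends within reach of 0, inside copy [i], or, from [Gx i] with [i] positive,
    inside the copy below. *)
Lemma caught_below (i : nat) :
  (forall j, j <= i -> caught chase (Gx (S j) : G) (Gw j)) ->
  forall r, In r (map (copy i) (K_nbrs Ky)) -> caught chase (Gx (S (S i)) : G) r.
Proof.
  intros Hw.
  assert (Hint : forall j r, j <= i -> In r (interior j) -> caught chase G0 r).
  { intros j r Hj. now apply caught_interior, Hw. }
  assert (Hi : forall r, In r (interior i) -> caught chase G0 r)
    by (intros r; now apply Hint).
  intros r Hr; simpl in Hr.
  destruct i as [| i];
    repeat destruct Hr as [<- | Hr]; try contradiction; solve_approach;
    try solve [apply Hi; simpl; auto 6];
    apply (Hint i); [apply Nat.le_succ_diag_r | simpl; auto 6 ..].
Qed.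

(** From y the cop plays z, z', y. The robber's only safe answers are t', then x, then a move into
    copy [i - 1], where [caught_below] and the induction hypothesis apply; below copy 0 there is
    none. *)
Lemma caught_w (i : nat) : caught chase (Gx (S i) : G) (Gw i).
Proof.
  induction i as [i IH] using lt_wf_ind.
  assert (Hx : caught chase (Gz' i : G) (Gx i)).
  { destruct i as [| i]; solve_approach;
      (apply caught_below;
       [intros j Hj; now apply IH, Nat.lt_succ_r | simpl; tauto]). }
  assert (Ht' : caught chase (Gz i : G) (Gt' i)) by solve_approach.
  solve_approach.
Qed.

Lemma G_cop_win : cop_win G.
Proof.
  apply (positional_cop_win G chase G0 chase_legal).
  intros [| i | i | i | i | i | i]; [apply caught_step; now left
    | apply caught_step, step_G0_Gx
    | apply (caught_interior i (caught_w i)); simpl; auto 6 ..].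
Qed.

(** * Constructing orders restricted to a copy *)

Lemma last_in_list {A : Type} {beta : ordinal} (x : beta -> A) :
  Injective x -> Surjective x -> forall (l : list A) (v : A),
  exists a, In (x a) (v :: l) /\
    forall c, In (x c) (v :: l) -> olt c a \/ c = a.
Proof.
  intros Hinj Hsurj l; induction l as [| u l IH]; intros v;
    destruct (Hsurj v) as [b <-].
  - exists b. split; [now left |].
    intros c [E | []]. right. now apply Hinj.
  - destruct (IH u) as [a [Ha Hmax]].
    destruct (olt_total beta a b) as [Hab | Hab].
    + exists b. split; [now left |].
      intros c [E | Hc]; [right; now apply Hinj |]. left.
      destruct (Hmax c Hc) as [Hca | ->]; [| easy].
      now apply (olt_trans beta c a b).
    + exists a. split; [now right |].
      intros c [E | Hc]; [| now apply Hmax].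
      apply Hinj in E as <-. destruct Hab as [-> | Hba]; auto.
Qed.

Lemma olt_irrefl {beta : ordinal} (a : beta) : ~ olt a a.
Proof.
  induction a as [a IH] using (well_founded_ind (olt_wf beta)).
  intros Ha. exact (IH a Ha Ha).
Qed.

(** For [k] other than [Kx], the closed neighbourhoods in G of [copy i k] and its neighbours in the
    copy meet only in [copy i k]; [Kx] is dominated by [Ky]. *)
Lemma dominated_within_copy (i : nat) (k : K) (u : G) :
  u <> copy i k ->
  (forall b, closed_nbhd k b -> closed_nbhd u (copy i b : G)) ->
  k = Kx.
Proof.
  intros Hne Hdom.
  (* The lists of the [copy i b] are used, since [u] may be [G0]. *)
  assert (Hin : forall b, In b (k :: K_nbrs k) ->
    In u (copy i b :: G_nbrs (copy i b))).
  { intros b Hb. apply step_G_nbrs; [now destruct b |].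
    apply step_sym, Hdom.
    destruct Hb as [<- | Hb]; [now left | right; now apply K_nbrs_spec]. }
  clear Hdom. apply Forall_forall in Hin.
  destruct k; [reflexivity | exfalso ..];
    repeat (apply Forall_cons_iff in Hin as [? Hin]); clear Hin;
    destruct i as [| i]; simpl in *;
    repeat match goal with
    | H : _ \/ _ |- _ =>
        destruct H as [H | H]; try discriminate; subst; try (now destruct Hne)
    | H : _ = _ |- _ => injection H; lia
    end; contradiction.
Qed.

(** When the last vertex of copy [i] is listed, the whole copy is present, so its dominator covers
    its neighbourhood in the copy, and that last vertex must be x. *)
Lemma y_before_x (beta : ordinal) (x : beta -> G) :
  Injective x -> Surjective x ->
  (forall a, (exists b, olt b a) -> exists c, olt c a /\
     exists u v : induced G (upto x a),
       proj1_sig u = x c /\ proj1_sig v = x a /\ dominates u v) ->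
  forall i a, x a = Gx i -> exists c, olt c a /\ x c = Gx (S i).
Proof.
  intros Hinj Hsurj Hdom i a Ha.
  destruct (last_in_list x Hinj Hsurj
    (map (copy i) [Ky; Kz; Kz'; Kt; Kt'; Kw]) (copy i Kx)) as [m [Hm Hmax]].
  change (In (x m) (map (copy i) [Kx; Ky; Kz; Kz'; Kt; Kt'; Kw])) in Hm.
  apply in_map_iff in Hm as [k [Hk _]].
  assert (Hall : forall b c, x c = copy i b -> olt c m \/ c = m).
  { intros b c Hc. apply Hmax. rewrite Hc. destruct b; simpl; tauto. }
  (* The copy has two distinct vertices, so its last one is not first in the order. *)
  assert (Hpos : exists b, olt b m).
  { destruct (Hsurj (Gx i)) as [b Hb], (Hsurj (Gx (S i))) as [c Hc].
    destruct (Hall Kx b Hb) as [Hlt | ->]; [now exists b |].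
    destruct (Hall Ky c Hc) as [Hlt | ->]; [now exists c |].
    rewrite Hb in Hc. injection Hc as Hc. now destruct (Nat.neq_succ_diag_r i). }
  destruct (Hdom m Hpos) as [c [Hcm [u [v [Hu [Hv [_ Hdv]]]]]]].
  assert (E : k = Kx).
  { apply (dominated_within_copy i k (proj1_sig u)).
    - rewrite Hu, Hk. intros E. apply Hinj in E as ->. exact (olt_irrefl m Hcm).
    - intros b Hb.
      destruct (Hsurj (copy i b)) as [d Hd].
      assert (Sb : upto x m (copy i b)) by (exists d; eauto).
      (* For [b = k] the witness is [v] itself: vertices of the induced graph carry membership
         proofs, so a rebuilt one need not equal [v]. *)
      assert (Hvb : exists e : induced G (upto x m),
        proj1_sig e = copy i b /\ closed_nbhd v e).
      { destruct Hb as [-> | Hb].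
        - exists v. split; [exact (eq_trans Hv (eq_sym Hk)) | now left].
        - exists (exist _ (copy i b : G) Sb). split; [reflexivity |].
          right. change (adj (proj1_sig v) (copy i b : G)).
          rewrite Hv, <- Hk. now apply G_adj_copy. }
      destruct Hvb as [e [He Hve]].
      rewrite <- He. destruct (Hdv e Hve) as [-> | Hue]; [now left | now right]. }
  subst k. destruct (Hsurj (Gx (S i))) as [d Hd].
  assert (a = m) as -> by (apply Hinj; now rewrite Ha, <- Hk).
  exists d. split; [| easy].
  destruct (Hall Ky d Hd) as [| ->]; [easy |].
  rewrite Ha in Hd. injection Hd as Hd. now destruct (Nat.neq_succ_diag_r i).
Qed.

Theorem theorem3 : cop_win G /\ ~ constructible G.
Proof.
  split; [exact G_cop_win |].
  intros [beta [x [Hinj [Hsurj Hdom]]]].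
  (* The index [i] stays general, as each step down the order raises it by one. *)
  assert (Hdesc : forall a i, x a <> Gx i).
  { intros a; induction a as [a IH] using (well_founded_ind (olt_wf beta)).
    intros i Ha.
    destruct (y_before_x beta x Hinj Hsurj Hdom i a Ha) as [c [Hca Hc]].
    exact (IH c Hca (S i) Hc). }
  destruct (Hsurj (Gx 0)) as [a Ha]. exact (Hdesc a 0 Ha).
Qed.
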